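(* Let $a$ and $b$ be integers. Then $\mathscr{G}(a,b)\neq\emptyset$ if and only if $(a,b)\in\mathscr{F}^*$, where $\mathscr{F}^*=\{(a,b)\neq(0,1)\mid a\ge 0 \text{ and } a^2+4b\ge 4\}$.
   Context: All graphs are finite, simple and undirected; the eigenvalues of a graph are those of its adjacency matrix $A$. An eigenvalue of a graph $G$ is a main eigenvalue if it has an eigenvector the sum of whose entries is nonzero. For integers $a,b$, $\mathscr{G}(a,b)$ denotes the set of connected graphs $G$ that have exactly two main eigenvalues and satisfy $\sum_{u\in N(v)}d(u)=a\,d(v)+b$ for every vertex $v\in V(G)$, where $N(v)$ is the neighbourhood and $d(v)$ the degree of $v$. *)

(* Defs.v *)
From HB Require Import structures.
From mathcomp Require Import all_boot all_order all_algebra.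
From mathcomp Require Import reals.

Set Implicit Arguments.
Unset Strict Implicit.
Unset Printing Implicit Defensive.

Import Order.TTheory GRing.Theory Num.Theory.
Local Open Scope ring_scope.

Record sgraph := SGraph {
  vertex :> finType;
  adj : rel vertex;
  adj_sym : symmetric adj;
  adj_irrefl : irreflexive adj
}.

Definition neighbours (G : sgraph) (v : G) : {set G} := [set u | adj v u].

Definition deg (G : sgraph) (v : G) : nat := #|neighbours v|.

Definition connected_graph (G : sgraph) : Prop :=
  (0 < #|G|)%N /\ forall u v : G, connect (@adj G) u v.

Definition adjmx (R : realType) (G : sgraph) : 'M[R]_#|G| :=
  \matrix_(i, j) (adj (enum_val i) (enum_val j))%:R.

(* MathComp's eigenvectors are row vectors; as [adjmx R G] is symmetric, they
   are the transposes of the usual column eigenvectors. *)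
Definition main_eigenvalue (R : realType) (G : sgraph) (l : R) : Prop :=
  eigenvalue (adjmx R G) l /\
  exists x : 'rV[R]_#|G|,
    [/\ (x <= eigenspace (adjmx R G) l)%MS, x != 0 & \sum_i x 0 i != 0].

Definition two_main_eigenvalues (R : realType) (G : sgraph) : Prop :=
  exists l m : R,
    l <> m /\ forall x : R, main_eigenvalue G x <-> x = l \/ x = m.

Definition in_scrG (R : realType) (a b : int) (G : sgraph) : Prop :=
  [/\ connected_graph G, two_main_eigenvalues R G &
      forall v : G,
        (\sum_(u in neighbours v) deg u)%N%:Z = a * (deg v)%:Z + b].

Definition Fstar : {pred int * int} :=
  [pred p | [&& p != (0, 1), 0 <= p.1 & 4 <= p.1 ^+ 2 + 4 * p.2]].

(* Main.v *)
Require Import Defs.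
From HB Require Import structures.
From mathcomp Require Import all_boot all_order all_algebra.
From mathcomp Require Import reals.
From mathcomp Require Import zify ring lra.
Import Order.TTheory GRing.Theory Num.Theory.
Local Open Scope ring_scope.

(**
  The spectral condition reduces to irregularity: if A d = a d + b 1 for the
  degree vector d = A 1, a main eigenvalue is a root of x^2 - a x - b; and if
  l, m are its two roots, then d - m 1 is an eigenvector for l, whose entries
  do not sum to zero unless it vanishes, that is, unless the graph is regular.

  For an irregular connected graph of minimum and maximum degrees p < q, the
  integer p lies strictly between the roots of x^2 - a x - b, since equality
  would propagate from neighbour to neighbour; hence a^2 + 4 b >= 4. Moreover
  a p + b <= p q <= a q + b, hence a >= 0.

  Conversely, the Cartesian product with the complete graph K_{r+1} turns a
  pair (a, b) into (a + 2 r, b - a r - r^2), keeping a^2 + 4 b, so it is enough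
  to treat (0, n) with n >= 2 (star K_{1,n}), (1, n) with n >= 1 (two stars
  K_{1,n} with adjacent centers) and (2, 0) (subdivided claw). The last one is
  needed because (0, 1) is not realizable.
*)

Definition irregular (G : sgraph) : Prop := exists u v : G, deg u != deg v.

Definition walk_linear (a b : int) (G : sgraph) : Prop :=
  forall v : G,
    (\sum_(u in neighbours v) deg u)%N%:Z = a * (deg v)%:Z + b.

(** * Main eigenvalues: exactly two of them versus irregularity *)

Section Spectrum.
Variables (R : realType) (G : sgraph).
Local Notation A := (adjmx R G).
Local Notation one := (const_mx 1 : 'rV[R]_#|G|).

Definition vertex_row (f : G -> nat) : 'rV[R]_#|G| :=
  \row_i (f (enum_val i))%:R.

Lemma adjmx_tr : A^T = A.
Proof. by apply/matrixP => i j; rewrite !mxE adj_sym. Qed.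

Lemma vertex_row_adjmx (f : G -> nat) :
  vertex_row f *m A = vertex_row (fun v => \sum_(u in neighbours v) f u)%N.
Proof.
apply/rowP => i; rewrite !mxE natr_sum [RHS]big_mkcond /=.
rewrite [RHS](big_enum_val (fun u : G => _)) /=; apply: eq_bigr => j _.
by rewrite !mxE inE adj_sym; case: adj; rewrite ?mulr1 ?mulr0.
Qed.

Lemma ones_adjmx : one *m A = vertex_row (@deg G).
Proof.
have -> : one = vertex_row (fun=> 1%N) by apply/rowP => i; rewrite !mxE.
by rewrite vertex_row_adjmx; apply/rowP => i; rewrite !mxE sum1_card.
Qed.

Lemma row_sumE (x : 'rV[R]_#|G|) : \sum_i x 0 i = (x *m one^T) 0 0.
Proof. by rewrite !mxE; apply: eq_bigr => i _; rewrite !mxE mulr1. Qed.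

(** Since the degree vector is A applied to the all-ones vector, symmetry of A lets A act on [x]
    instead. *)
Lemma eigen_degree_sum {l : R} {x : 'rV[R]_#|G|} :
  x *m A = l *: x -> x *m (vertex_row (@deg G))^T = l *: (x *m one^T).
Proof. by move=> xA; rewrite -ones_adjmx trmx_mul adjmx_tr mulmxA xA scalemxAl. Qed.

(** In a k-regular graph the degree vector is k times [one], so [eigen_degree_sum] gives k s = l s
    for the entry sum s of an eigenvector for l. If s is nonzero then l = k, so at most one
    eigenvalue is main. *)
Lemma two_main_irregular : two_main_eigenvalues R G -> irregular G.
Proof.
case=> l [m [lm main]]; have [/existsP[u /existsP[v uv]]|reg] :=
  boolP [exists u : G, [exists v : G, deg u != deg v]]; first by exists u, v.
have [k degk] : exists k, forall v : G, deg v = k.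
  case: (pickP (fun _ : G => true)) => [w _|nG].
    exists (deg w) => v; apply/eqP; move: reg; rewrite negb_exists => /forallP/(_ v).
    by rewrite negb_exists => /forallP/(_ w); rewrite negbK.
  (* Without vertices any value would do. *)
  by exists 0%N => v; have := nG v.
have mainE x : main_eigenvalue G x -> x = k%:R :> R.
  case=> _ [y [/eigenspaceP/eigen_degree_sum yA _]]; rewrite row_sumE => s0.
  move: yA; have -> : vertex_row (@deg G) = k%:R *: one.
    by apply/rowP => i; rewrite !mxE degk mulr1.
  rewrite linearZ /= -scalemxAr => /matrixP/(_ 0 0); rewrite [LHS]mxE [RHS]mxE.
  by move/(mulIf s0).
have el : l = k%:R by apply: mainE; apply (main l); left.
have em : m = k%:R by apply: mainE; apply (main m); right.
by case: lm; rewrite el em.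
Qed.

Lemma irregular_two_main (a b : int) :
    0 < a ^+ 2 + 4 * b -> irregular G -> walk_linear a b G ->
  two_main_eigenvalues R G.
Proof.
move=> disc [u [v uv]] wl.
pose d := vertex_row (@deg G).
have dA : d *m A = a%:~R *: d + b%:~R *: one.
  rewrite vertex_row_adjmx; apply/rowP => i; rewrite !mxE mulr1.
  by rewrite pmulrn wl rmorphD rmorphM.
pose s : R := Num.sqrt (a ^+ 2 + 4 * b)%:~R.
have s2 : s ^+ 2 = a%:~R ^+ 2 + 4 * b%:~R.
  by rewrite sqr_sqrtr ?ler0z ?ltW // rmorphD rmorphXn rmorphM.
have s0 : 0 < s by rewrite sqrtr_gt0 ltr0z.
(* By Vieta, l and m are the two roots of X^2 - a X - b. The claim is applied to both orders of the
   roots. *)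
have main (l m : R) : l + m = a%:~R -> l * m = - b%:~R -> main_eigenvalue G l.
  move=> lm_a lm_b; pose x := d - m *: one.
  have xA : x *m A = l *: x.
    rewrite mulmxBl dA -scalemxAl ones_adjmx -/d -lm_a.
    rewrite -[b%:~R]opprK -lm_b; apply/rowP => i; rewrite !mxE; ring.
  have x0 : x != 0.
    apply: contra uv => /eqP/rowP x0; rewrite -(eqr_nat R).
    have dm (w : G) : (deg w)%:R = m.
      by move: (x0 (enum_rank w)); rewrite !mxE enum_rankK mulr1 => /subr0_eq.
    by rewrite !dm.
  have eig : (x <= eigenspace A l)%MS by apply/eigenspaceP.
  split; first by apply/eigenvalueP; exists x.
  exists x; split=> //; apply: contra x0; rewrite row_sumE => /eqP sx.
  (* If the entries of [x] sum to 0, then [x] is orthogonal to [one], hence to [d] by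
     [eigen_degree_sum], hence to [x] = d - m 1 itself. A real vector of norm 0 vanishes. *)
  have xx : (x *m x^T) 0 0 = 0.
    have -> : x^T = d^T - m *: one^T by rewrite linearB linearZ.
    rewrite mulmxBr -scalemxAr (eigen_degree_sum xA).
    by rewrite !mxE in sx *; rewrite sx !mulr0 subr0.
  have {}xx : \sum_j x 0 j ^+ 2 = 0.
    by rewrite -[RHS]xx [RHS]mxE; apply: eq_bigr => j _; rewrite [x^T _ _]mxE.
  apply/eqP/rowP => i; rewrite [RHS]mxE; apply/eqP; rewrite -sqrf_eq0; apply/eqP.
  by apply: psumr_eq0P xx i isT => j _; apply: sqr_ge0.
exists ((a%:~R + s) / 2), ((a%:~R - s) / 2); split; first by lra.
move=> l; split=> [[_ [x [/eigenspaceP xA _]]]|]; last first.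
  by case=> ->; [apply: (main _ ((a%:~R - s) / 2))
                |apply: (main _ ((a%:~R + s) / 2))]; nra.
rewrite row_sumE => t0; have xd := eigen_degree_sum xA.
(* Pairing [x] with d A = a d + b 1 gives l^2 t = a l t + b t for the entry sum t of [x], and t is
   nonzero. *)
have : x *m (d *m A)^T = l *: (x *m d^T).
  by rewrite trmx_mul adjmx_tr mulmxA xA scalemxAl.
rewrite dA linearD !linearZ /= mulmxDr -!scalemxAr xd.
have scaleE c (M : 'M[R]_1) : (c *: M) 0 0 = c * M 0 0 by rewrite mxE.
move/matrixP/(_ 0 0); rewrite [LHS]mxE !scaleE.
set t := (x *m one^T) 0 0 => eq_t.
have : (l - (a%:~R + s) / 2) * (l - (a%:~R - s) / 2) * t = 0.
  have -> : (l - (a%:~R + s) / 2) * (l - (a%:~R - s) / 2)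
          = l * l - a%:~R * l - b%:~R by field: s2.
  by rewrite !mulrBl; lra.
move/eqP; rewrite !mulf_eq0 (negPf t0) orbF !subr_eq0.
by case/orP=> /eqP ->; [left|right].
Qed.

End Spectrum.

(** * Necessity: bounds from vertices of extreme degree *)

Lemma walk_linear_Fstar (a b : int) (G : sgraph) :
  connected_graph G -> irregular G -> walk_linear a b G -> (a, b) \in Fstar.
Proof.
move=> [_ conn] [x [y xy]] wl.
have [v _ minv] := @arg_minnP _ x xpredT (@deg G) isT.
have [w _ maxw] := @arg_maxnP _ x xpredT (@deg G) isT.
have min_lt_max : (deg v < deg w)%N.
  rewrite ltnNge; apply: contra xy => wv.
  have := minv x isT; have := minv y isT.
  have := maxw x isT; have := maxw y isT => /=; lia.
have sum_ge (u : G) : (deg u * deg v <= \sum_(z in neighbours u) deg z)%N.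
  by rewrite -sum_nat_const leq_sum // => z _; apply: minv.
have sum_le (u : G) : (\sum_(z in neighbours u) deg z <= deg u * deg w)%N.
  by rewrite -sum_nat_const leq_sum // => z _; apply: maxw.
have sum_gt : (deg v * deg v < \sum_(z in neighbours v) deg z)%N.
  rewrite ltn_neqAle sum_ge andbT; apply/negP => /eqP eqv.
  (* All vertices of minimum degree have the same neighbour sum. If it equals the lower bound, all
     their neighbours have minimum degree too, and by connectedness so does [w]. *)
  have cl : closed (@adj G) [pred u | deg u == deg v].
    apply: intro_closed; first exact/sym_connect_sym/adj_sym.
    move=> u z uz; rewrite !inE => /eqP duv.
    have sumE : (\sum_(z in neighbours u) deg z = \sum_(z in neighbours u) deg v)%N.
      rewrite sum_nat_const -/(deg u) duv eqv; apply/eqP.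
      by rewrite -eqz_nat !wl duv.
    have leq_dv (t : G) : t \in neighbours u ->
        (deg v <= deg t ?= iff (deg v == deg t))%N.
      by move=> _; apply/leqif_eq/minv.
    have := (leqif_sum leq_dv).2; rewrite sumE eqxx => /esym/forall_inP/(_ z).
    by rewrite inE eq_sym; apply.
  have := closed_connect cl (conn v w); rewrite !inE eqxx => /esym/eqP; lia.
have := sum_ge w; have := sum_le v; have := sum_gt.
rewrite -ltz_nat -!lez_nat !wl !PoszM => lt_v le_v ge_w.
have {}min_lt_max : (deg v)%:Z < (deg w)%:Z by [].
have v_ge0 : 0 <= (deg v)%:Z by [].
rewrite !inE /=; apply/and3P; split.
(* For (0, 1) the minimum degree p satisfies p^2 < 1, so [v] is isolated and its neighbour sum is 0,
   against [sum_gt]. *)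
- apply/eqP => -[a0 b1]; subst a b.
  have v0 : deg v = 0%N by nia.
  by move: sum_gt; rewrite (eq_bigl xpred0) ?big_pred0 // => z; rewrite (card0_eq v0).
- have : 0 <= a * ((deg w)%:Z - (deg v)%:Z) by lia.
  by rewrite pmulr_lge0 // subr_gt0.
(* With p = [deg v], integrality turns p^2 < a p + b into p^2 - a p - b <= -1, so (2 p - a)^2 <= a^2
   + 4 b - 4. *)
- have := sqr_ge0 (2 * (deg v)%:Z - a); lia.
Qed.

Lemma connected_from (G : sgraph) (r : G) :
  (forall v, connect (@adj G) r v) -> connected_graph G.
Proof.
move=> conn; split=> [|u v]; first by apply/card_gt0P; exists r.
by apply: connect_trans (conn v); rewrite (sym_connect_sym (@adj_sym G)).
Qed.

(** * Cartesian products and the shift of (a, b) *)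

Section CartesianProduct.
Variables G H : sgraph.

Definition box_adj : rel (G * H) := fun p q =>
  adj p.1 q.1 && (p.2 == q.2) || (p.1 == q.1) && adj p.2 q.2.

Lemma box_adj_sym : symmetric box_adj.
Proof.
by move=> p q; rewrite /box_adj adj_sym (adj_sym p.2) (eq_sym p.1) (eq_sym p.2).
Qed.

Lemma box_adj_irrefl : irreflexive box_adj.
Proof. by move=> p; rewrite /box_adj !adj_irrefl andbF. Qed.

Definition box : sgraph := SGraph box_adj_sym box_adj_irrefl.

(** A neighbour of [p] changes exactly one coordinate. The two kinds are disjoint because adjacency
    is irreflexive. *)
Lemma box_sum (F : box -> nat) (p : box) :
  (\sum_(q in neighbours p) F q =
   \sum_(u in neighbours p.1) F (u, p.2) +
   \sum_(j in neighbours p.2) F (p.1, j))%N.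
Proof.
have -> : neighbours p = [set (u, p.2) | u in neighbours p.1]
                     :|: [set (p.1, j) | j in neighbours p.2].
  apply/setP => -[u j]; rewrite !inE /= /box_adj /=; congr (_ || _).
    apply/andP/imsetP => [[pu /eqP <-]|[w]]; first by exists u; rewrite ?inE.
    by rewrite inE => pw [-> ->].
  apply/andP/imsetP => [[/eqP <- pj]|[w]]; first by exists j; rewrite ?inE.
  by rewrite inE => pw [-> ->].
rewrite (eq_bigl _ _ (fun q => in_setU q _ _)) bigU /=; last first.
  rewrite disjoint_subset; apply/subsetP => q /imsetP[u pu ->].
  rewrite inE; apply/negP => /imsetP[j _ [up _]].
  by move: pu; rewrite inE up adj_irrefl.
by congr addn; rewrite big_imset //= => x y _ _ [].
Qed.

Lemma box_deg (p : box) : deg p = (deg p.1 + deg p.2)%N.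
Proof. by rewrite /deg -!sum1_card box_sum. Qed.

(** Walk in the first factor with the second coordinate fixed, then in the second factor. *)
Lemma box_connected :
  connected_graph G -> connected_graph H -> connected_graph box.
Proof.
move=> [/card_gt0P[u0 _] connG] [/card_gt0P[i0 _] connH].
apply: (@connected_from box (u0, i0)) => -[u i].
apply: (@connect_trans _ _ (u, i0)).
  have /connectP[s + ->] := connG u0 u.
  elim: s u0 => [|v s IHs] w //= /andP[wv /IHs]; apply: connect_trans.
  by apply: connect1; rewrite /adj /= /box_adj /= wv eqxx.
have /connectP[s + ->] := connH i0 i.
elim: s i0 => [|j s IHs] k //= /andP[kj /IHs]; apply: connect_trans.
by apply: connect1; rewrite /adj /= /box_adj /= kj eqxx orbT.
Qed.

(** Over a vertex of degree d in [G], the neighbour sum is (a d + b + r d) + r (d + r), to be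
    written in terms of the new degree d + r. Both roots of X^2 - a X - b move by r. *)
Lemma box_walk_linear (a b : int) (r : nat) :
    (forall i : H, deg i = r) -> walk_linear a b G ->
  walk_linear (a + 2 * r%:Z) (b - a * r%:Z - r%:Z ^+ 2) box.
Proof.
move=> regH wl p.
rewrite box_sum (eq_bigr (fun u => deg u + r)%N) => [|u _]; last first.
  by rewrite box_deg regH.
rewrite [X in (_ + X)%N](eq_bigr (fun=> deg p.1 + r)%N) => [|j _]; last first.
  by rewrite box_deg regH.
rewrite big_split /= !sum_nat_const box_deg -!/(deg _) regH.
rewrite !PoszD wl !PoszM !PoszD; ring.
Qed.

End CartesianProduct.

Section CompleteGraph.
Variable n : nat.

Definition complete_adj : rel 'I_n := fun i j => i != j.

Lemma complete_adj_sym : symmetric complete_adj.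
Proof. by move=> i j; rewrite /complete_adj eq_sym. Qed.

Lemma complete_adj_irrefl : irreflexive complete_adj.
Proof. by move=> i; rewrite /complete_adj eqxx. Qed.

Definition complete : sgraph := SGraph complete_adj_sym complete_adj_irrefl.

Lemma complete_deg (i : complete) : deg i = n.-1.
Proof.
have -> : deg i = #|[set~ i]|.
  by apply: eq_card => j; rewrite !inE eq_sym.
by rewrite cardsC1 card_ord.
Qed.

Lemma complete_connected : (0 < n)%N -> connected_graph complete.
Proof.
move=> n0; apply: (@connected_from complete (Ordinal n0)) => i.
have [<-|ni] := eqVneq (Ordinal n0) i; first exact: connect0.
exact: connect1.
Qed.

End CompleteGraph.

(** A purely combinatorial form of nonemptiness, free of the real field: irregularity stands in for
    the two main eigenvalues. *)
Definition realizable (a b : int) : Prop :=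
  exists G, [/\ connected_graph G, irregular G & walk_linear a b G].

Lemma realizable_shift (a b : int) (r : nat) :
  realizable a b ->
  realizable (a + 2 * r%:Z) (b - a * r%:Z - r%:Z ^+ 2).
Proof.
case=> G [conn [u [v uv]] wl]; exists (box G (complete r.+1)); split.
- exact: (box_connected _ _ conn (complete_connected r.+1 isT)).
- exists (u, ord0), (v, ord0); rewrite !box_deg !complete_deg.
  by rewrite eqn_add2r.
- by apply: box_walk_linear => // i; rewrite complete_deg.
Qed.

(** * Base graphs: stars, double stars and the subdivided claw *)

Section Star.
Variable n : nat.

(** [None] is the center and each [Some i] is a leaf. *)
Definition star_adj : rel (option 'I_n) := fun x y => isSome x != isSome y.

Lemma star_adj_sym : symmetric star_adj.
Proof. by move=> x y; rewrite /star_adj eq_sym. Qed.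

Lemma star_adj_irrefl : irreflexive star_adj.
Proof. by move=> x; rewrite /star_adj eqxx. Qed.

Definition star : sgraph := SGraph star_adj_sym star_adj_irrefl.

Lemma star_center_sum (F : star -> nat) :
  (\sum_(x in @neighbours star None) F x = \sum_(i < n) F (Some i))%N.
Proof.
have -> : @neighbours star None = [set Some i | i : 'I_n].
  apply/setP => -[i|]; rewrite inE; apply/esym/imsetP; first by exists i.
  by case.
by rewrite big_imset //= => i j _ _ [].
Qed.

Lemma star_leaf_sum (F : star -> nat) (i : 'I_n) :
  (\sum_(x in @neighbours star (Some i)) F x = F None)%N.
Proof.
have -> : @neighbours star (Some i) = [set None].
  by apply/setP => -[j|]; rewrite !inE.
by rewrite big_set1.
Qed.

(** A leaf sees one vertex of degree n and the center sees n leaves, so every neighbour sum is n.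
    For n = 1 the star is regular. *)
Lemma star_realizable : (1 < n)%N -> realizable 0 n%:Z.
Proof.
move=> n1; have n0 := ltnW n1.
have dc : @deg star None = n.
  by rewrite /deg -sum1_card star_center_sum sum1_card card_ord.
have dl i : @deg star (Some i) = 1%N by rewrite /deg -sum1_card star_leaf_sum.
exists star; split.
- apply: (@connected_from star None) => -[i|]; last exact: connect0.
  exact: connect1.
- by exists None, (Some (Ordinal n0)); rewrite dc dl -(subnK n1) addn2.
- move=> [i|]; first by rewrite star_leaf_sum dc mul0r add0r.
  rewrite star_center_sum (eq_bigr (fun=> 1%N)) // sum1_card card_ord.
  by rewrite mul0r add0r.
Qed.

End Star.

Section DoubleStar.
Variable n : nat.

(** The boolean selects one of the two stars, and [None] is its center. *)
Definition double_star_adj : rel (bool * option 'I_n) := fun x y =>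
  match x.2, y.2 with
  | None, None => x.1 != y.1
  | Some _, Some _ => false
  | _, _ => x.1 == y.1
  end.

Lemma double_star_adj_sym : symmetric double_star_adj.
Proof. by move=> [c [i|]] [d [j|]]; rewrite /double_star_adj //= eq_sym. Qed.

Lemma double_star_adj_irrefl : irreflexive double_star_adj.
Proof. by move=> [c [i|]]; rewrite /double_star_adj //= eqxx. Qed.

Definition double_star : sgraph :=
  SGraph double_star_adj_sym double_star_adj_irrefl.

Lemma double_star_center_sum (F : double_star -> nat) (c : bool) :
  (\sum_(x in @neighbours double_star (c, None)) F x =
   F (~~ c, None) + \sum_(i < n) F (c, Some i))%N.
Proof.
have -> : @neighbours double_star (c, None)
        = (~~ c, None) |: [set (c, Some i) | i : 'I_n].
  apply/setP => -[d [i|]]; rewrite !inE xpair_eqE /= ?andbF ?andbT /=.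
    apply/eqP/imsetP => /= [<-|[j _ [-> _]]] //; by exists i.
  rewrite [_ \in _](_ : _ = false) ?orbF; last by apply/imsetP => -[].
  by rewrite /adj /= /double_star_adj; case: c d => -[].
rewrite big_setU1 /=; last by apply/imsetP => -[].
by rewrite big_imset //= => i j _ _ [].
Qed.

Lemma double_star_leaf_sum (F : double_star -> nat) (c : bool) (i : 'I_n) :
  (\sum_(x in @neighbours double_star (c, Some i)) F x = F (c, None))%N.
Proof.
have -> : @neighbours double_star (c, Some i) = [set (c, None)].
  apply/setP => -[d [j|]]; rewrite !inE xpair_eqE ?andbF //= andbT.
  by rewrite eq_sym.
by rewrite big_set1.
Qed.

(** A leaf has degree 1 and neighbour sum n + 1. A center has degree n + 1 and neighbour sum (n + 1)
    + n. *)
Lemma double_star_realizable : (0 < n)%N -> realizable 1 n%:Z.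
Proof.
move=> n0.
have dc c : @deg double_star (c, None) = n.+1.
  by rewrite /deg -sum1_card double_star_center_sum sum1_card card_ord.
have dl c i : @deg double_star (c, Some i) = 1%N.
  by rewrite /deg -sum1_card double_star_leaf_sum.
exists double_star; split.
- apply: (@connected_from double_star (true, None)) => -[c x].
  apply: (@connect_trans _ _ (c, None)).
    by case: c; [apply: connect0|apply: connect1].
  case: x => [i|]; last exact: connect0.
  by apply: connect1; apply: eqxx.
- by exists (true, None), (true, Some (Ordinal n0)); rewrite dc dl; case: n n0.
- move=> [c [i|]]; first by rewrite double_star_leaf_sum dc dl; lia.
  rewrite double_star_center_sum !dc (eq_bigr (fun=> 1%N)) //.
  by rewrite sum1_card card_ord; lia.
Qed.

End DoubleStar.

(* [None] is the center,
   [Some (i, false)] the middle and [Some (i, true)] the end of the i-th leg. *)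
Section SubdividedClaw.

Definition claw_adj : rel (option ('I_3 * bool)) := fun x y =>
  match x, y with
  | None, Some (_, e) | Some (_, e), None => ~~ e
  | Some (i, e), Some (j, e') => (i == j) && (e != e')
  | None, None => false
  end.

Lemma claw_adj_sym : symmetric claw_adj.
Proof.
by move=> [[i e]|] [[j e']|] //=; rewrite eq_sym [e == _]eq_sym.
Qed.

Lemma claw_adj_irrefl : irreflexive claw_adj.
Proof. by move=> [[i e]|] //=; rewrite !eqxx. Qed.

Definition claw : sgraph := SGraph claw_adj_sym claw_adj_irrefl.

Lemma claw_center_sum (F : claw -> nat) :
  (\sum_(x in @neighbours claw None) F x = \sum_(i < 3) F (Some (i, false)))%N.
Proof.
have -> : @neighbours claw None = [set Some (i, false) | i : 'I_3].
  apply/setP => -[[i []]|]; rewrite inE; apply/esym/imsetP; try by case.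
  by exists i.
by rewrite big_imset //= => i j _ _ [].
Qed.

Lemma claw_mid_sum (F : claw -> nat) (i : 'I_3) :
  (\sum_(x in @neighbours claw (Some (i, false))) F x =
   F None + F (Some (i, true)))%N.
Proof.
have -> : @neighbours claw (Some (i, false)) = [set None; Some (i, true)].
  apply/setP => -[[j e]|]; rewrite !inE //=.
  by rewrite /adj /= [RHS]/(_ == _) /= xpair_eqE eq_sym; case: e.
by rewrite big_setU1 ?inE // big_set1.
Qed.

Lemma claw_end_sum (F : claw -> nat) (i : 'I_3) :
  (\sum_(x in @neighbours claw (Some (i, true))) F x = F (Some (i, false)))%N.
Proof.
have -> : @neighbours claw (Some (i, true)) = [set Some (i, false)].
  by apply/setP => -[[j e]|]; rewrite !inE.
by rewrite big_set1.
Qed.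

(** The degrees 1, 2, 3 have neighbour sums 2, 3 + 1 and 3 * 2, twice the degree each time. *)
Lemma claw_realizable : realizable 2 0.
Proof.
have dc : @deg claw None = 3%N.
  by rewrite /deg -sum1_card claw_center_sum sum1_card card_ord.
have dm i : @deg claw (Some (i, false)) = 2%N.
  by rewrite /deg -sum1_card claw_mid_sum.
have de i : @deg claw (Some (i, true)) = 1%N.
  by rewrite /deg -sum1_card claw_end_sum.
exists claw; split.
- have cm i : connect (@adj claw) None (Some (i, false)) by apply: connect1.
  apply: (@connected_from claw None) => -[[i []]|]; last exact: connect0.
    apply: connect_trans (cm i) _; apply: connect1.
    by rewrite /adj /= eqxx.
  exact: cm.
- by exists None, (Some (ord0, false)); rewrite dc dm.
- move=> [[i []]|].
  + by rewrite claw_end_sum dm de.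
  + by rewrite claw_mid_sum dc dm de.
  + by rewrite claw_center_sum dc !big_ord_recl big_ord0 !dm.
Qed.

End SubdividedClaw.

(** * Sufficiency: reaching every pair by shifts *)

Lemma Fstar_realizable (a b : int) : (a, b) \in Fstar -> realizable a b.
Proof.
rewrite !inE /= xpair_eqE => /and3P[ab0 a0 disc].
have [m am] : exists m : nat, a = m by exists `|a|%N; rewrite gez0_abs.
(* Undoing a shift by [r] = floor(a / 2) leaves first coordinate e = 0 or 1 and second coordinate N
   = b + e r + r^2, with e^2 + 4 N = a^2 + 4 b >= 4, hence N >= 1. *)
pose r := m./2; have am2 : a = (odd m)%:Z + 2 * r%:Z.
  by rewrite am -{1}(odd_double_half m) -/r; lia.
clearbody r; case: (odd m) am2 => /= {am m} am2.
  pose N := absz (b + r%:Z + r%:Z ^+ 2).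
  have NE : N%:Z = b + r%:Z + r%:Z ^+ 2 by rewrite /N gez0_abs //; nia.
  have := realizable_shift _ _ r (double_star_realizable N _).
  rewrite NE; have -> : b + r%:Z + r%:Z ^+ 2 - 1 * r%:Z - r%:Z ^+ 2 = b by ring.
  by rewrite -am2; apply; rewrite -ltz_nat NE; nia.
pose N := absz (b + r%:Z ^+ 2).
have NE : N%:Z = b + r%:Z ^+ 2 by rewrite /N gez0_abs //; nia.
have [N1|N1] := ltnP 1 N.
  have := realizable_shift _ _ r (star_realizable N N1).
  by rewrite NE mul0r subr0 addrK am2.
(* Here N = 1, so the pair is the shift of (0, 1) by [r]. The case r = 0 is the excluded pair, and
   otherwise the claw's pair (2, 0), itself the shift of (0, 1) by 1, is shifted by r - 1. *)
have bE : b = 1 - r%:Z ^+ 2 by nia.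
case: r {N NE N1} am2 bE disc ab0 => [|r] am2 bE _ ab0.
  by move: ab0; rewrite am2 bE.
have := realizable_shift _ _ r claw_realizable.
have -> : 2 + 2 * r%:Z = a by lia.
by have -> : 0 - 2 * r%:Z - r%:Z ^+ 2 = b by rewrite bE; lia.
Qed.

Theorem theorem2p14 (R : realType) (a b : int) :
  (exists G : sgraph, in_scrG R a b G) <-> (a, b) \in Fstar.
Proof.
split=> [[G [conn main wl]]|ab].
  exact: (walk_linear_Fstar _ _ _ conn (two_main_irregular _ _ main) wl).
have [G [conn irr wl]] := Fstar_realizable _ _ ab; exists G; split=> //.
apply: (irregular_two_main _ _ a b) => //; move: ab; rewrite !inE /=.
by case/and3P=> _ _; apply: lt_le_trans.
Qed.
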